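(* Let $\boldsymbol F=\sum_{k\ge0}(-1)^kz^kF^{(k)}$ be the generating series of Hodge integrals with one $\lambda$-class, let $\boldsymbol l=zl_1+z^2l_2+\cdots$ be the first order linear differential operator with $e^{\boldsymbol l}=\boldsymbol L$, and let $\overline{\mathrm{KP}}_{i,j}$ ($2\le i\le j$) be the transformed KP equations (all defined in the context). Consider the expression $$e^{-\boldsymbol l}\;\overline{\mathrm{KP}}_{i,j}\bigl(e^{\boldsymbol l}\boldsymbol F\bigr)$$ as a series in $z$. Then its coefficient of $z^k$ is a finite differential equation (that is, one with a finite number of terms) on $F^{(0)},\dots,F^{(k)}$.
   Context: Hodge integrals. $\langle\tau_{d_1}\cdots\tau_{d_n}\rangle^{(k)}=\int_{\overline{\mathcal M}_{g,n}}\psi_1^{d_1}\cdots\psi_n^{d_n}\lambda_k$ for $k+\sum d_i=3g-3+n$, and the bracket vanishes otherwise; $\lambda_k$ is the $k$-th Chern class of the Hodge bundle ($\lambda_0=1$). $F^{(k)}(t_0,t_1,\dots)=\sum_{n}\frac1{n!}\sum_{d_1,\dots,d_n}\langle\tau_{d_1}\cdots\tau_{d_n}\rangle^{(k)}t_{d_1}\cdots t_{d_n}$. Operators. Define rational numbers $a_{d,d+k}$ by $$\sum_{b=1}^{d+1}\frac{(-1)^{d-b+1}}{(d-b+1)!\,(b-1)!}\cdot\frac1{1-b\psi}=\psi^d+\sum_{k\ge1}a_{d,d+k}\psi^{d+k}.$$ Put $\boldsymbol L=1+zL_1+z^2L_2+\cdots$ with $$L_k=\sum_{p\ge1}\frac1{p!}\sum_{\substack{k_1+\dots+k_p=k\\k_i\ge1}}\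 \sum_{n_1,\dots,n_p\ge0}\Bigl(\prod_{i=1}^pa_{n_i,n_i+k_i}\,t_{n_i}\Bigr)\frac{\partial^p}{\partial t_{n_1+k_1}\cdots\partial t_{n_p+k_p}} .$$ One has $\boldsymbol L=e^{\boldsymbol l}$ with $\boldsymbol l=\sum_{k\ge1}z^kl_k$, $l_k=\sum_{n\ge0}\alpha_{n,n+k}\,t_n\frac{\partial}{\partial t_{n+k}}$ for uniquely determined rational constants $\alpha_{n,n+k}$. KP equations. For partitions $\lambda,\mu$ of the same integer $d$, $\chi_\mu(\lambda)$ is the value on cycle type $\lambda$ of the irreducible character of $S_d$ assigned to $\mu$ ($\mu=(d)$ being the trivial one), $|\mathrm{Aut}(\lambda)|$ is the number of permutations of the parts of $\lambda$ preserving their values, $d_i=\partial/\partial p_i$, and $D_\mu=\sum_{|\lambda|=|\mu|}\chi_\mu(\lambda)\,d_{\lambda_1}\cdots d_{\lambda_m}/|\mathrm{Aut}(\lambda)|$, where $m$ is the number of parts of $\lambda$. For $2\le i\le j$, $$\mathrm{Hir}_{i,j}(\tau)=D_{()}\tau\cdot D_{(j,i)}\tau-D_{(i-1)}\tau\cdot D_{(j,1)}\tau+D_{(j)}\tau\cdot D_{(i-1,1)}\tau ,\qquad \mathrm{KP}_{i,j}(G)=\frac{\mathrm{Hir}_{i,j}(e^G)}{e^{2G}}.$$ For instance $\mathrm{KP}_{2,2}(G)=G_{2,2}-G_{1,3}+\frac12G_{1,1}^2+\frac1{12}G_{1,1,1,1}$, an index $i$ denoting $\partial/\partial p_i$. Transformed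 equations. Let $h_{g;b_1,\dots,b_n}$ be the number of degree $d=\sum b_i$ ramified coverings of the sphere by a genus $g$ surface with $n$ numbered preimages of $\infty$ of multiplicities $b_1,\dots,b_n$ and $d+n+2g-2$ fixed simple branch points, and let $$H=\sum_{g,n}\frac1{n!}\sum_{b_1,\dots,b_n}\frac{\beta^{d+n+2g-2}}{(d+n+2g-2)!}\,h_{g;b_1,\dots,b_n}\,p_{b_1}\cdots p_{b_n}.$$ It satisfies $\mathrm{KP}_{i,j}(H)=0$. Let $H_{\rm unst}$ be the part of $H$ with $g=0$, $n=1,2$: $$H_{\rm unst}=\sum_{b\ge1}\beta^{b-1}\frac{b^{b-2}}{b!}p_b+\frac12\sum_{b_1,b_2\ge1}\beta^{b_1+b_2}\frac{b_1^{b_1}b_2^{b_2}}{(b_1+b_2)\,b_1!\,b_2!}p_{b_1}p_{b_2},$$ and $H_{\rm st}=H-H_{\rm unst}$. Substituting $H=H_{\rm st}+H_{\rm unst}$ with this explicit $H_{\rm unst}$ transforms $\mathrm{KP}_{i,j}(H)=0$ into an equation on $H_{\rm st}$. Apply to it the linear change of variables $$p_b=\sum_{d\ge b-1}\frac{(-1)^{d-b+1}}{(d-b+1)!\,b^{b-1}}\beta^{-b-(2d+1)/3}\,t_d,\quad\text{i.e.}\quad \frac{\partial}{\partial p_b}=b^{b-1}\sum_{d=0}^{b-1}\frac{\beta^{b+(2d+1)/3}}{(b-d-1)!}\frac{\partial}{\partial t_d},$$ and replace $\beta^{2/3}$ by $z$ (an overall power of $\beta$ being divided out). Under this change of variables and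 replacement $H_{\rm st}$ becomes $\boldsymbol L\boldsymbol F$, and the resulting equation on $\boldsymbol L\boldsymbol F$ is denoted $\overline{\mathrm{KP}}_{i,j}$. For instance $$\overline{\mathrm{KP}}_{2,2}(G)=-\frac{\partial^2G}{\partial t_0\partial t_1}+\frac12\Bigl(\frac{\partial^2G}{\partial t_0^2}\Bigr)^2+\frac1{12}\frac{\partial^4G}{\partial t_0^4}+z\Bigl(4\frac{\partial^2G}{\partial t_1^2}-9\frac{\partial^2G}{\partial t_0\partial t_2}\Bigr).$$
   Formalization: For (i,j)≠(2,2), terms of KP_{i,j}(G) containing a first derivative of G are removed (a triangularly equivalent system), because substituting the first derivatives of H_unst otherwise gives infinitely many terms with unbounded negative powers of z. *)

(* Defs.v *)
From HB Require Import structures.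
From mathcomp Require Import all_boot all_order all_algebra all_fingroup.
From mathcomp Require Import all_solvable all_field all_character.
From mathcomp Require Import finmap multiset.

Set Implicit Arguments.
Unset Strict Implicit.
Unset Printing Implicit Defensive.

Import GRing.Theory.
Local Open Scope nat_scope.
Local Open Scope mset_scope.
Local Open Scope ring_scope.

(* A formal power series over rat in t_0, t_1, ...; the multiset m stands for
   the monomial with exponent m d at t_d. *)
Definition tser := {mset nat} -> rat.

Definition tpart (d : nat) (f : tser) : tser :=
  fun m => (m d).+1%:R * f (d +` m).

Definition tvar (n : nat) (f : tser) : tser :=
  fun m => if n \in m then f (m `\ n) else 0.

Definition tparts (ds : seq nat) (f : tser) : tser := foldr tpart f ds.
Definition tvars (ns : seq nat) (f : tser) : tser := foldr tvar f ns.

Definition submsets (m : {mset nat}) : seq {mset nat} :=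
  undup [seq seq_mset (mask (val b) (enum_mset m))
        | b : (size (enum_mset m)).-tuple bool].

Definition tmul (f g : tser) : tser :=
  fun m => \sum_(m1 <- submsets m) f m1 * g (m `\` m1).

Definition tone : tser := fun m => (m == mset0)%:R.

(* A strict bound on the indices of the variables in m.  In the operators
   sum_n c_n t_n d/dt_(n+k), the terms with n >= tbound m do not contribute to
   the coefficient of m. *)
Definition tbound (m : {mset nat}) : nat := (\max_(d <- enum_mset m) d).+1.

(* Power series in s = beta^(1/3) with coefficients in tser.  Since
   z = beta^(2/3) = s^2, the coefficient of z^k is the one of s^(2k).  The
   equations below may mix both parities of s, so s is used throughout. *)
Definition sser := nat -> tser.

Definition smul (f g : sser) : sser :=
  fun r m => \sum_(q < r.+1) tmul (f q) (g (r - q)%N) m.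

Definition sone : sser := fun r m => (r == 0%N)%:R * tone m.

(* sum_k (-1)^k z^k F_k *)
Definition zser (F : nat -> tser) : sser :=
  fun r m => if odd r then 0 else (-1) ^+ r./2 * F r./2 m.

(* The data on the moduli spaces of stable curves from which Hodge integrals
   are formed: for each (g, n), a commutative ring of classes, the psi classes,
   the Chern classes of the Hodge bundle, and integration over the fundamental
   class. *)
Record hodge_data := HodgeData {
  coh : nat -> nat -> comAlgType rat;
  psi : forall g n : nat, 'I_n -> coh g n;
  lam : forall g n : nat, nat -> coh g n;
  lam0 : forall g n : nat, lam g n 0 = 1;
  integral : forall g n : nat, {linear coh g n -> rat^o}
}.

(* <tau_(d_1) ... tau_(d_n)>^(k); at most one g contributes, the stable one of
   the correct dimension, if any. *)
Definition bracket (M : hodge_data) (k : nat) (ds : seq nat) : rat :=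
  let n := size ds in
  \sum_(g < (k + sumn ds).+4
       | (2 < 2 * g + n)%N && (3 * g + n == k + sumn ds + 3)%N)
    integral M g n
      ((\prod_(i < n) psi M g i ^+ nth 0%N ds i) * lam M g n k).

Definition hodgeF (M : hodge_data) (k : nat) : tser :=
  fun m => ((size (enum_mset m))`!%:R)^-1 *
           \sum_(ds <- permutations (enum_mset m)) bracket M k ds.

(* a_(d,e): the coefficient of psi^e in
   sum_b (-1)^(d-b+1) / ((d-b+1)! (b-1)!) * 1 / (1 - b psi). *)
Definition acoef (d e : nat) : rat :=
  \sum_(1 <= b < d.+2)
    (-1) ^+ (d.+1 - b)%N / ((d.+1 - b)`! * (b.-1)`!)%:R * b%:R ^+ e.

Definition Lcoef (k : nat) (f : tser) : tser := fun m =>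
  \sum_(1 <= p < k.+1) (p`!%:R)^-1 *
    \sum_(ks : {ffun 'I_p -> 'I_k.+1}
         | [forall i, (0 < ks i)%N] && (\sum_i (ks i : nat) == k)%N)
      \sum_(ns : {ffun 'I_p -> 'I_(tbound m)})
        (\prod_i acoef (ns i) (ns i + ks i)) *
        tvars [seq (ns i : nat) | i : 'I_p]
          (tparts [seq (ns i + ks i)%N | i : 'I_p] f) m.

Definition Lop (f : sser) : sser := fun r m =>
  f r m + \sum_(1 <= k < r./2.+1) Lcoef k (f (r - k.*2)%N) m.

Definition lcoef (alpha : nat -> nat -> rat) (k : nat) (f : tser) : tser :=
  fun m => \sum_(n < tbound m) alpha n (n + k)%N * tvar n (tpart (n + k)%N f) m.

Definition lop (alpha : nat -> nat -> rat) (f : sser) : sser := fun r m =>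
  \sum_(1 <= k < r./2.+1) lcoef alpha k (f (r - k.*2)%N) m.

(* e^T for an operator T divisible by z, so that T^p vanishes modulo s^(2p). *)
Definition sexp (T : sser -> sser) (f : sser) : sser := fun r m =>
  \sum_(p < r.+1) (p`!%:R)^-1 * iter p T f r m.

Definition sopp (T : sser -> sser) (f : sser) : sser := fun r m => - T f r m.

(* L = e^l *)
Definition log_of_L (alpha : nat -> nat -> rat) : Prop :=
  forall (f : sser) r m, Lop f r m = sexp (lop alpha) f r m.

Definition is_partition (d : nat) (s : seq nat) : bool :=
  [&& sorted geq s, 0%N \notin s & sumn s == d].

(* Row and column stabilisers of the tableau of shape mu with entries 0, 1, ...
   in reading order. *)
Definition row_stab (mu : seq nat) (d : nat) : {set 'S_d} :=
  [set w : 'S_d | [forall k, reshape_index mu (w k) == reshape_index mu k]].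
Definition col_stab (mu : seq nat) (d : nat) : {set 'S_d} :=
  [set w : 'S_d | [forall k, reshape_offset mu (w k) == reshape_offset mu k]].

(* The irreducible character of S_d assigned to mu: the one that does not
   vanish on the Young symmetrizer of mu, i.e. the character of the irreducible
   left ideal which the symmetrizer generates in the group algebra. *)
Definition Sd_irr (mu : seq nat) (d : nat) : option (Iirr [set: 'S_d]%G) :=
  [pick i : Iirr [set: 'S_d]%G
  | \sum_(r in row_stab mu d) \sum_(c in col_stab mu d)
      (-1) ^+ odd_perm c * 'chi_i (r * c)%g != 0].

Definition has_cycle_type (d : nat) (la : seq nat) (w : 'S_d) : bool :=
  perm_eq (map (fun C : {set 'I_d} => #|C|) (enum (porbits w))) la.

(* chi_mu(la); the defaults are never used for partitions mu, la of the same
   integer, and the value, an integer, is read in rat. *)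
Definition chi (mu la : seq nat) : rat :=
  let d := sumn mu in
  if Sd_irr mu d is Some i then
    if [pick w : 'S_d | has_cycle_type la w] is Some w then getCrat ('chi_i w)
    else 0
  else 0.

Definition aut_size (la : seq nat) : nat :=
  \prod_(v <- undup la) (count_mem v la)`!.

Fixpoint insert_each (x : nat) (pi : seq (seq nat)) : seq (seq (seq nat)) :=
  if pi is B :: pi' then
    ((x :: B) :: pi') :: [seq B :: q | q <- insert_each x pi']
  else [::].

(* The set partitions of the positions of s. *)
Fixpoint setparts (s : seq nat) : seq (seq (seq nat)) :=
  if s is x :: s' then
    flatten [seq ([:: x] :: pi) :: insert_each x pi | pi <- setparts s']
  else [:: [::]].

(* Below, J B stands for the iterated derivative d_B G, B a word.
   expjet J la is e^(-G) d_(la_1) ... d_(la_m) e^G; the recursion of setparts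
   is that of the operators d_x + (d_x G). *)
Definition expjet (J : seq nat -> sser) (la : seq nat) : sser := fun r m =>
  \sum_(pi <- setparts la) (\big[smul/sone]_(B <- pi) J B) r m.

(* e^(-G) D_mu e^G *)
Definition Djet (J : seq nat -> sser) (mu : seq nat) : sser := fun r m =>
  let d := sumn mu in
  \sum_(p < d.+1) \sum_(la : p.-tuple 'I_d.+1 | is_partition d (map val la))
    chi mu (map val la) / (aut_size (map val la))%:R *
    expjet J (map val la) r m.

(* KP_(i,j)(G) = Hir_(i,j)(e^G) / e^(2G) *)
Definition KPjet (i j : nat) (J : seq nat -> sser) : sser := fun r m =>
  smul (Djet J [::]) (Djet J [:: j; i]) r m
  - smul (Djet J [:: i.-1]) (Djet J [:: j; 1%N]) r m
  + smul (Djet J [:: j]) (Djet J [:: i.-1; 1%N]) r m.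

(* d/dp_b in the variables t *)
Definition ppart (b : nat) (G : sser) : sser := fun r m =>
  \sum_(d < b | (3 * b + (2 * d + 1) <= r)%N)
    (b ^ b.-1)%:R / ((b - d.+1)`!)%:R *
    tpart d (G (r - (3 * b + (2 * d + 1)))%N) m.

Definition pparts (B : seq nat) (G : sser) : sser := foldr ppart G B.

(* The derivatives of order at least 2 of H_unst, which is of degree 2 in p. *)
Definition unst_jet (B : seq nat) : sser := fun r m =>
  if B is [:: b1; b2] then
    (r == 3 * (b1 + b2))%N%:R * tone m *
    ((b1 ^ b1 * b2 ^ b2)%:R / ((b1 + b2) * (b1`! * b2`!))%:R)
  else 0.

(* The equation KP_(i,j)(H) = 0, H = G + H_unst, on G = H_st in the variables t,
   in its form free of first derivatives.  Subtracting from G its linear part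
   at a point shows that, for any G,
     KP_(i,j)(G) = sum_(a,b >= 0) h_a h_b KP'_(i-a,j-b)(G),
   where KP' is KP without the terms containing some first derivative d_b G,
   sum_n h_n y^n = exp(sum_b (d_b G) y^b), KP'_(i,j) = - KP'_(j+1,i-1), and
   KP'_(i,j) = 0 if i <= 1 or j <= 0.  So the equations KP' = 0 and KP = 0 are
   triangularly equivalent.  First derivatives have to be eliminated:
   KP_(2,3) contains (d_1 G) KP_(2,2)(G), and
   d_1 H_unst = 1 + sum_d (-1)^d / (d+2)! beta^((2-2d)/3) t_d
   is an infinite sum with unbounded negative powers of beta. *)
Definition KPtrans (i j : nat) (G : sser) : sser :=
  KPjet i j (fun B r m =>
    if (size B < 2)%N then 0 else pparts B G r m + unst_jet B r m).

(* s^N divides the equation identically; the overall power of beta to be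
   divided out corresponds to the largest such N. *)
Definition beta_divides (N i j : nat) : Prop :=
  forall (G : sser) (r : nat) m, (r < N)%N -> KPtrans i j G r m = 0.

(* The transformed equation divided by s^N = beta^(N/3). *)
Definition KPbar (N i j : nat) (G : sser) : sser :=
  fun r => KPtrans i j G (r + N)%N.

(* A differential polynomial, as a finite list of terms.  The term
   (c, [:: (k_1, w_1); ...]) is c times the product of the derivatives of the
   k_a-th unknown with respect to the t_d, d in w_a. *)
Definition diffpoly := seq (rat * seq (nat * seq nat)).

Definition deval (P : diffpoly) (F : nat -> tser) : tser := fun m =>
  \sum_(c <- P) c.1 * (\big[tmul/tone]_(u <- c.2) tparts u.2 (F u.1)) m.

Definition involves_upto (k : nat) (P : diffpoly) : bool :=
  all (fun c : rat * seq (nat * seq nat) =>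
         all (fun u : nat * seq nat => (u.1 <= k)%N) c.2) P.

(* Main.v *)
(**
Write T = -l. It is a derivation divisible by z, so e^T is an automorphism of
the differential algebra of series, inverse to e^l; the iterated commutators of
T with d/dt_d have constant coefficients, hence conjugation by e^T turns d/dt_d
into a series in z whose coefficients are finite constant-coefficient operators.
Therefore each coefficient of the conjugated equation is a differential
polynomial in the unknowns.

That the coefficient of order r involves the F_k with 2k <= r only requires the
equation, after division by s^N, to depend on its argument to order r only. Let
a series in s be encoded as a series constant in s, a new variable t_D taking
the place of s: by assumption the coefficients of s^e with e < N vanish on the
encoded series, and substituting t_D := s afterwards leaves powers of t_D at
most r in the coefficients of s^e, e >= N, of total order r + N.
*)

Require Import Defs.
From HB Require Import structures.
From mathcomp Require Import all_boot all_order all_algebra.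
From mathcomp Require Import finmap multiset boolp functions zify.

Set Implicit Arguments.
Unset Strict Implicit.
Unset Printing Implicit Defensive.

Import GRing.Theory Num.Theory.
Local Open Scope nat_scope.
Local Open Scope mset_scope.
Local Open Scope ring_scope.

(** * The algebra of power series in the variables t_d *)

HB.instance Definition _ := GRing.Lmodule.copy tser ({mset nat} -> rat^o).
HB.instance Definition _ := GRing.Lmodule.copy sser (nat -> tser).

Lemma tserP (f g : tser) : f =1 g -> f = g.
Proof. exact: funext. Qed.

Lemma sserP (f g : sser) : (forall r, f r = g r) -> f = g.
Proof. exact: funext. Qed.

Lemma tsumE I (s : seq I) P (f : I -> tser) m :
  (\sum_(i <- s | P i) f i) m = \sum_(i <- s | P i) f i m.
Proof. by elim/big_rec2: _ => // i a b _ <-. Qed.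

Lemma ssumE I (s : seq I) P (f : I -> sser) r :
  (\sum_(i <- s | P i) f i) r = \sum_(i <- s | P i) f i r.
Proof. by elim/big_rec2: _ => // i a b _ <-. Qed.

Lemma tscaleE (c : rat) (f : tser) m : (c *: f) m = c * f m.
Proof. by []. Qed.

Lemma taddE (f g : tser) m : (f + g) m = f m + g m.
Proof. by []. Qed.

Lemma mem_submsets (x m : {mset nat}) : (x \in submsets m) = (x `<=` m).
Proof.
rewrite /submsets mem_undup; apply/mapP/idP => [[b _ ->]|].
  apply/msubsetP => a; rewrite mset_seqE -[leqRHS]count_mem_mset.
  exact/leq_count_subseq/mask_subseq.
move=> /msubsetP xm.
(* Comparing multiplicities shows that the enumeration of [x] is, up to permutation, a subsequence
   of that of [m], hence is cut out by a mask. *)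
have /count_subseqP[s /subseqP[b sb ->] xs] :
    forall a, (count_mem a (enum_mset x) <= count_mem a (enum_mset m))%N.
  by move=> a; rewrite !count_mem_mset.
exists (tcast sb (in_tuple b)); first by rewrite mem_enum.
rewrite /= val_tcast /= -[LHS]seq_mset_id; exact/eq_seq_msetP.
Qed.

Lemma submsets_uniq m : uniq (submsets m).
Proof. exact: undup_uniq. Qed.

Lemma big_submsets_ge (a m : {mset nat}) (F : {mset nat} -> rat) : a `<=` m ->
  \sum_(x <- submsets m | a `<=` x) F x
  = \sum_(b <- submsets (m `\` a)) F (a `+` b).
Proof.
move=> am; rewrite -big_filter.
rewrite -(big_map (msetD a) xpredT F); apply: perm_big; apply: uniq_perm.
- exact/filter_uniq/submsets_uniq.
- by rewrite map_inj_uniq ?submsets_uniq //; exact: can_inj (msetDKB a).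
move=> x; rewrite mem_filter mem_submsets; apply/andP/mapP => [[ax xm]|[b]].
  exists (x `\` a); first by rewrite mem_submsets msetSB.
  by rewrite msetBDKC.
rewrite mem_submsets => bm ->; split.
  by apply/msubsetP => e; rewrite msetE2 leq_addr.
by rewrite -(msetBDKC am) msetDS.
Qed.

Lemma big_submsets_le (x m : {mset nat}) (F : {mset nat} -> rat) : x `<=` m ->
  \sum_(a <- submsets m | a `<=` x) F a = \sum_(a <- submsets x) F a.
Proof.
move=> xm; rewrite -big_filter; apply: perm_big; apply: uniq_perm.
- exact/filter_uniq/submsets_uniq.
- exact: submsets_uniq.
move=> a; rewrite mem_filter !mem_submsets andb_idr // => ax.
exact: msubset_trans ax xm.
Qed.

Lemma big_submsets_compl (m : {mset nat}) (F : {mset nat} -> rat) :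
  \sum_(x <- submsets m) F x = \sum_(x <- submsets m) F (m `\` x).
Proof.
rewrite -(big_map (msetB m) xpredT F); apply: perm_big; apply: uniq_perm.
- exact: submsets_uniq.
- rewrite map_inj_in_uniq ?submsets_uniq // => x y.
  rewrite !mem_submsets => xm ym e.
  by rewrite -(msetBBK xm) e msetBBK.
move=> x; rewrite mem_submsets; apply/idP/mapP => [xm|[y _ ->]].
  exists (m `\` x); last by rewrite msetBBK.
  by rewrite mem_submsets msubsetDl.
by rewrite msubsetDl.
Qed.

Lemma tmulC f g : tmul f g = tmul g f.
Proof.
apply: tserP => m; rewrite /tmul big_submsets_compl; apply: eq_big_seq => x.
by rewrite mem_submsets => xm; rewrite mulrC msetBBK.
Qed.

(** Both sides are sums over chains a <= x <= m of multisets. With a taken outermost, x is written a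
    + b, where b runs over the submultisets of m - a. *)
Lemma tmulA f g h : tmul f (tmul g h) = tmul (tmul f g) h.
Proof.
apply: tserP => m; rewrite /tmul.
under [RHS]eq_big_seq => x.
  rewrite mem_submsets => xm; rewrite -(big_submsets_le _ xm) mulr_suml.
  over.
rewrite [RHS](exchange_big_dep xpredT) //=; apply: eq_big_seq => a.
rewrite mem_submsets => am; rewrite big_submsets_ge // mulr_sumr.
apply: eq_bigr => b _.
by rewrite -mulrA msetBDA msetDKB.
Qed.

Lemma tmul1 f : tmul tone f = f.
Proof.
apply: tserP => m; rewrite /tmul (bigD1_seq mset0) ?submsets_uniq //=; last first.
  by rewrite mem_submsets msub0set.
rewrite /tone eqxx mul1r msetB0 big1 ?addr0 // => a /negPf ->.
by rewrite mul0r.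
Qed.

HB.instance Definition _ := Monoid.isComLaw.Build tser tone tmul tmulA tmulC tmul1.

Lemma tmul_is_linear f : linear (tmul f).
Proof.
move=> c g h; apply: tserP => m.
rewrite /tmul taddE tscaleE mulr_sumr -big_split /=.
by apply: eq_bigr => a _; rewrite taddE tscaleE mulrDr !mulrA [f a * c]mulrC.
Qed.
HB.instance Definition _ f :=
  GRing.isLinear.Build rat tser tser *:%R (tmul f) (tmul_is_linear f).

Lemma tpart_is_linear d : linear (tpart d).
Proof.
move=> c g h; apply: tserP => m.
by rewrite /tpart !taddE !tscaleE mulrDr mulrCA.
Qed.
HB.instance Definition _ d :=
  GRing.isLinear.Build rat tser tser *:%R (tpart d) (tpart_is_linear d).

Lemma tvar_is_linear n : linear (tvar n).
Proof.
move=> c g h; apply: tserP => m; rewrite taddE tscaleE /tvar.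
by case: ifP => // _; rewrite mulr0 addr0.
Qed.
HB.instance Definition _ n :=
  GRing.isLinear.Build rat tser tser *:%R (tvar n) (tvar_is_linear n).

Lemma tmulZl c f g : tmul (c *: f) g = c *: tmul f g.
Proof. by rewrite tmulC linearZ /= tmulC. Qed.

Lemma tmulZr c f g : tmul f (c *: g) = c *: tmul f g.
Proof. by rewrite linearZ. Qed.

Lemma tmul_suml I (s : seq I) P (F : I -> tser) g :
  tmul (\sum_(i <- s | P i) F i) g = \sum_(i <- s | P i) tmul (F i) g.
Proof.
by rewrite tmulC linear_sum; apply: eq_bigr => i _; rewrite tmulC.
Qed.

Lemma tpart_tmul d f g :
  tpart d (tmul f g) = tmul (tpart d f) g + tmul f (tpart d g).
Proof.
have weighted (a b : tser) (m : {mset nat}) :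
    \sum_(x <- submsets (d +` m)) (x d)%:R * (a x * b ((d +` m) `\` x))
    = tmul (tpart d a) b m.
  (* The parts x without d have weight zero; the others are d plus a submultiset of m. *)
  rewrite (bigID (fun x : {mset nat} => [mset d] `<=` x)) /=.
  rewrite [X in _ + X]big1 ?addr0; last first.
    by move=> x; rewrite msub1set -mset_eq0 => /eqP ->; rewrite mul0r.
  rewrite big_submsets_ge; last first.
    by apply/msubsetP => e; rewrite msetE2 leq_addr.
  rewrite msetDKB /tmul; apply: eq_bigr => x _.
  rewrite msetBDl /tpart mulrA; congr (_%:R * _ * _).
  by rewrite mset1DE eqxx.
apply: tserP => m; rewrite taddE [tmul f (_ _)]tmulC -!weighted.
rewrite [X in _ + X]big_submsets_compl -big_split /= /tpart /tmul mulr_sumr.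
apply: eq_big_seq => x; rewrite mem_submsets => xm.
rewrite msetBBK // [g _ * _]mulrC -mulrDl -natrD; congr (_%:R * _).
by rewrite msetE2 subnKC ?(msubsetP xm) // mset1DE eqxx.
Qed.

(** As a product with a monomial, multiplication by t_n moves through products by associativity. *)
Lemma tvarE n f : tvar n f = tmul (fun a => (a == [mset n])%:R) f.
Proof.
apply: tserP => m; rewrite /tvar /tmul; case: ifPn => nm.
  rewrite (bigD1_seq [mset n]) ?submsets_uniq //=; last first.
    by rewrite mem_submsets msub1set.
  by rewrite eqxx mul1r big1 ?addr0 // => a /negPf ->; rewrite mul0r.
rewrite big_seq big1 // => a; rewrite mem_submsets => am.
case: eqP => [e|]; last by rewrite mul0r.
by rewrite e msub1set (negPf nm) in am.
Qed.

Lemma tvar_tmull n f g : tmul (tvar n f) g = tvar n (tmul f g).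
Proof. by rewrite !tvarE tmulA. Qed.

Lemma tvar_tmulr n f g : tmul f (tvar n g) = tvar n (tmul f g).
Proof. by rewrite tmulC tvar_tmull tmulC. Qed.

Lemma tpartC d e f : tpart d (tpart e f) = tpart e (tpart d f).
Proof.
apply: tserP => m; rewrite /tpart !mulrA ![_ +` (_ +` _)]msetDA.
rewrite [[mset d] `+` [mset e]]msetDC; congr (_ * _).
rewrite !mset1DE [d == e]eq_sym; case: eqP => [->//|_].
by rewrite !add0n mulrC.
Qed.

Lemma tpart_tvar d n f :
  tpart d (tvar n f) = tvar n (tpart d f) + (d == n)%:R *: f.
Proof.
apply: tserP => m; rewrite taddE tscaleE /tpart /tvar in_mset1D eq_sym.
have [<-{n}|nd] /= := eqVneq d n.
  rewrite msetD1K mul1r; case: ifPn => dm.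
    rewrite msetB1E eqxx msetB1K //.
    by rewrite subn1 prednK ?mset_gt0 // -natr1 mulrDl mul1r.
  by rewrite add0r; move: dm; rewrite -mset_eq0 => /eqP ->; rewrite mul1r.
rewrite mul0r addr0; case: ifPn => nm; last by rewrite mulr0.
by rewrite msetB1E (negPf nd) subn0 msetDBA // msub1set.
Qed.

Lemma tpart_tone d : tpart d tone = 0.
Proof.
apply: tserP => m; rewrite /tpart /tone; case: eqP => [e|_]; last by rewrite mulr0.
by have := mset1D1 d m; rewrite e in_mset0.
Qed.

Lemma tvar0_out n f m : n \notin m -> tvar n f m = 0.
Proof. by rewrite /tvar => /negPf ->. Qed.

Lemma tbound_ub d (m : {mset nat}) : d \in m -> (d < tbound m)%N.
Proof.
by move=> dm; rewrite /tbound ltnS (big_rem d) //= leq_max leqnn.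
Qed.

Lemma tmul_eq_le f f' g g' (m : {mset nat}) :
  (forall a, a `<=` m -> f a = f' a) -> (forall a, a `<=` m -> g a = g' a) ->
  tmul f g m = tmul f' g' m.
Proof.
move=> ff gg; apply: eq_big_seq => a; rewrite mem_submsets => am.
by rewrite ff // gg // msubsetDl.
Qed.

(** * Power series in s, with [shift e] the multiplication by s^e *)

Definition shift (e : nat) (f : sser) : sser :=
  fun r => if (e <= r)%N then f (r - e)%N else 0.

Lemma shift_shift a b f : shift a (shift b f) = shift (a + b) f.
Proof.
apply: sserP => r; rewrite /shift.
case: (leqP a r) => ar; last by rewrite leqNgt (leq_trans ar) ?leq_addr.
by rewrite leq_subRL // subnDA.
Qed.

Lemma shift_is_linear e : linear (shift e).
Proof.
move=> c f g; apply: sserP => r; rewrite /shift.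
change ((if (e <= r)%N then c *: f (r - e)%N + g (r - e)%N else 0) =
  c *: (if (e <= r)%N then f (r - e)%N else 0)
  + (if (e <= r)%N then g (r - e)%N else 0)).
by case: ifP => // _; rewrite scaler0 addr0.
Qed.
HB.instance Definition _ e :=
  GRing.isLinear.Build rat sser sser *:%R (shift e) (shift_is_linear e).

Lemma smulE f g r : smul f g r = \sum_(q < r.+1) tmul (f q) (g (r - q)%N).
Proof. by apply: tserP => m; rewrite tsumE. Qed.

Lemma smulC f g : smul f g = smul g f.
Proof.
apply: sserP => r; rewrite !smulE (reindex_inj rev_ord_inj) /=.
by apply: eq_bigr => q _; rewrite tmulC subSS subKn // -ltnS.
Qed.

Lemma smul_eq_le f f' g g' r :
  (forall q, (q <= r)%N -> f q = f' q) -> (forall q, (q <= r)%N -> g q = g' q) ->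
  smul f g r = smul f' g' r.
Proof.
move=> ff gg; rewrite !smulE; apply: eq_bigr => q _.
by rewrite ff -1?ltnS // gg // leq_subr.
Qed.

Lemma smul_is_linear f : linear (smul f).
Proof.
move=> c g h; apply: sserP => r.
change (smul f (c *: g + h) r = c *: smul f g r + smul f h r).
rewrite !smulE scaler_sumr -big_split; apply: eq_bigr => q _.
by rewrite /= -linearP.
Qed.
HB.instance Definition _ f :=
  GRing.isLinear.Build rat sser sser *:%R (smul f) (smul_is_linear f).

Lemma smulZl c f g : smul (c *: f) g = c *: smul f g.
Proof. by rewrite smulC linearZ /= smulC. Qed.

Lemma smul_suml I (s : seq I) P (F : I -> sser) g :
  smul (\sum_(i <- s | P i) F i) g = \sum_(i <- s | P i) smul (F i) g.
Proof.
by rewrite smulC linear_sum; apply: eq_bigr => i _; rewrite smulC.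
Qed.

Lemma shift_smul e f g : smul (shift e f) g = shift e (smul f g).
Proof.
apply: sserP => r; rewrite smulE /shift.
rewrite -(big_mkord xpredT (fun q =>
  tmul (if (e <= q)%N then f (q - e)%N else 0) (g (r - q)%N))).
have zero a b : (b <= e)%N -> \sum_(a <= q < b)
    tmul (if (e <= q)%N then f (q - e)%N else 0) (g (r - q)%N) = 0.
  move=> be; rewrite big_nat big1 // => q /andP[_ qb].
  by rewrite leqNgt (leq_trans qb be) tmulC linear0.
case: leqP => er; last exact: zero.
rewrite (@big_cat_nat _ _ _ e) //=; last exact: leqW.
rewrite zero // add0r smulE -{1}[e]add0n big_addn subSn // big_mkord.
by apply: eq_bigr => q _; rewrite leq_addl addnK subnDA subnAC.
Qed.

(** * The operator l as a derivation *)

Definition lcs alpha k (f : sser) : sser := fun r => lcoef alpha k (f r).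

(** The range of summation in [lcoef] depends on the monomial. Any larger range K gives the same
    coefficient, so identities can be proved for one finite sum of operators. *)
Lemma lcoefE alpha k f K m : (tbound m <= K)%N ->
  lcoef alpha k f m =
  (\sum_(n < K) alpha n (n + k)%N *: tvar n (tpart (n + k) f)) m.
Proof.
move=> mK; rewrite tsumE /lcoef.
rewrite (big_ord_widen _ (fun n => alpha n (n + k)%N *
  tvar n (tpart (n + k) f) m) mK) big_mkcond.
apply: eq_bigr => n _; case: ifPn => // nm.
by rewrite tscaleE tvar0_out ?mulr0 //; apply: contra nm; exact: tbound_ub.
Qed.

Lemma lcoef_is_linear alpha k : linear (lcoef alpha k).
Proof.
move=> c f g; apply: tserP => m.
rewrite taddE tscaleE !(lcoefE _ _ _ (leqnn _)) -tscaleE -taddE.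
congr ((_ : tser) m); rewrite scaler_sumr -big_split; apply: eq_bigr => n _.
by rewrite /= [tpart _ _]linearP [tvar _ _]linearP scalerDr !scalerA mulrC.
Qed.
HB.instance Definition _ alpha k :=
  GRing.isLinear.Build rat tser tser *:%R (lcoef alpha k)
    (lcoef_is_linear alpha k).

Lemma tbound_le (a m : {mset nat}) : a `<=` m -> (tbound a <= tbound m)%N.
Proof.
move=> am; rewrite /tbound ltnS; apply/bigmax_leqP_seq => d da _.
by rewrite -ltnS; apply: tbound_ub; exact: msubset_subset am _ da.
Qed.

(** Each t_n d/dt_(n+k) is a derivation. To work with a single finite sum, the range belonging to m
    is used for all submultisets of m as well, these being the only ones that enter the coefficient
    of m. *)
Lemma lcoef_tmul alpha k f g :
  lcoef alpha k (tmul f g)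
  = tmul (lcoef alpha k f) g + tmul f (lcoef alpha k g).
Proof.
apply: tserP => m; rewrite taddE (lcoefE _ _ _ (leqnn _)).
have E (h : tser) a : a `<=` m -> lcoef alpha k h a = (\sum_(n < tbound m)
    alpha n (n + k)%N *: tvar n (tpart (n + k) h)) a.
  by move=> am; rewrite (lcoefE _ _ _ (tbound_le am)).
rewrite (tmul_eq_le (E f) (fun _ _ => erefl (g _))).
rewrite (tmul_eq_le (fun _ _ => erefl (f _)) (E g)) -taddE.
congr ((_ : tser) m); rewrite tmul_suml linear_sum -big_split.
apply: eq_bigr => n _ /=.
by rewrite tmulZl linearZ /= -scalerDr tvar_tmull tvar_tmulr -linearD tpart_tmul.
Qed.

Lemma tpart_lcoef alpha d k f :
  tpart d (lcoef alpha k f) = lcoef alpha k (tpart d f)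
    + alpha d (d + k)%N *: tpart (d + k) f.
Proof.
apply: tserP => m; rewrite taddE.
(* K suits the monomials on both sides and exceeds d, so that n = d, the only term not commuting
   with d/dt_d, is in range. *)
pose K := maxn (tbound m) (maxn (tbound (d +` m)) d.+1).
rewrite (lcoefE _ _ _ (leq_maxl _ _ : (tbound m <= K)%N)) {1}/tpart.
rewrite (@lcoefE _ _ _ K); last by rewrite leq_max leq_max leqnn orbT.
rewrite -/(tpart d _ m) -taddE; congr ((_ : tser) m).
have dK : (d < K)%N by rewrite !leq_max leqnn !orbT.
rewrite linear_sum (bigD1 (Ordinal dK)) //= [in RHS](bigD1 (Ordinal dK)) //=.
rewrite addrAC -!linearZ /=; congr (_ + _).
  by rewrite !linearZ /= tpart_tvar eqxx scale1r tpartC scalerDr.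
apply: eq_bigr => n nd; rewrite linearZ /= tpart_tvar tpartC.
case: eqP => [e|_]; first by rewrite -val_eqE /= e eqxx in nd.
by rewrite scale0r addr0.
Qed.

(** Up to a given order in s, l is a fixed finite sum of z^k l_k with z = s^2. *)
Lemma lopE alpha f K r : (r./2 < K)%N ->
  lop alpha f r = (\sum_(1 <= k < K) shift k.*2 (lcs alpha k f)) r.
Proof.
move=> rK; apply: tserP => m; rewrite ssumE tsumE /lop.
rewrite [RHS](@big_cat_nat _ _ _ r./2.+1) //=.
rewrite [X in _ = _ + X](_ : _ = 0) ?addr0; last first.
  rewrite big_nat big1 // => k /andP[kr _]; rewrite /shift ifF //.
  by apply/negbTE; lia.
apply: eq_big_nat => k /andP[_ kr]; rewrite /shift ifT //.
by lia.
Qed.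

Lemma lcs_is_linear alpha k : linear (lcs alpha k).
Proof.
move=> c f g; apply: sserP => r; rewrite /lcs.
exact: (lcoef_is_linear alpha k c (f r) (g r)).
Qed.
HB.instance Definition _ alpha k :=
  GRing.isLinear.Build rat sser sser *:%R (lcs alpha k) (lcs_is_linear alpha k).

Lemma lcs_smul alpha k f g :
  lcs alpha k (smul f g) = smul (lcs alpha k f) g + smul f (lcs alpha k g).
Proof.
apply: sserP => r.
change (lcoef alpha k (smul f g r) =
  smul (lcs alpha k f) g r + smul f (lcs alpha k g) r).
rewrite !smulE linear_sum -big_split; apply: eq_bigr => q _ /=.
by rewrite lcoef_tmul.
Qed.

Lemma lcs_shift alpha k e f : lcs alpha k (shift e f) = shift e (lcs alpha k f).
Proof.
by apply: sserP => r; rewrite /lcs /shift; case: ifP => // _; rewrite linear0.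
Qed.

Lemma smul_shift e f g : smul f (shift e g) = shift e (smul f g).
Proof. by rewrite smulC shift_smul smulC. Qed.

Lemma lop_is_linear alpha : linear (lop alpha).
Proof.
move=> c f g; apply: sserP => r.
change (lop alpha (c *: f + g) r = c *: lop alpha f r + lop alpha g r).
rewrite !(lopE _ _ (ltnSn _)).
rewrite -[RHS]/((c *: _ + _ : sser) r); congr ((_ : sser) r).
rewrite scaler_sumr -big_split; apply: eq_bigr => k _.
by rewrite /= [lcs _ _ _]linearP [LHS]linearP.
Qed.
HB.instance Definition _ alpha :=
  GRing.isLinear.Build rat sser sser *:%R (lop alpha) (lop_is_linear alpha).

Lemma lop_shift alpha e f : lop alpha (shift e f) = shift e (lop alpha f).
Proof.
apply: sserP => r; rewrite (lopE _ _ (ltnSn _)).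
transitivity (shift e (\sum_(1 <= k < r./2.+1) shift k.*2 (lcs alpha k f)) r).
  rewrite linear_sum; congr ((_ : sser) r); apply: eq_bigr => k _.
  by rewrite lcs_shift /= !shift_shift addnC.
rewrite /shift; case: ifP => // er; rewrite -lopE //.
by lia.
Qed.

Lemma lop_smul alpha f g :
  lop alpha (smul f g) = smul (lop alpha f) g + smul f (lop alpha g).
Proof.
apply: sserP => r.
change (lop alpha (smul f g) r =
  smul (lop alpha f) g r + smul f (lop alpha g) r).
have E (h : sser) q : (q <= r)%N ->
    lop alpha h q = (\sum_(1 <= k < r./2.+1) shift k.*2 (lcs alpha k h)) q.
  by move=> qr; rewrite -lopE // ltnS half_leq.
rewrite E // (smul_eq_le (E f) (fun _ _ => erefl (g _))).
rewrite (smul_eq_le (fun _ _ => erefl (f _)) (E g)).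
rewrite -[RHS]/((_ + _ : sser) r); congr ((_ : sser) r).
rewrite smul_suml linear_sum -big_split; apply: eq_bigr => k _ /=.
by rewrite shift_smul smul_shift lcs_smul -linearD.
Qed.

(** * Exponentials of operators that raise the order in s *)

Definition raising (T : sser -> sser) : Prop :=
  forall f g r, (forall q, (q < r)%N -> f q = g q) -> T f r = T g r.

Lemma lop_raising alpha : raising (lop alpha).
Proof.
move=> f g r fg; apply: tserP => m; rewrite /lop; apply: eq_big_nat => k.
by move=> /andP[k1 kr]; rewrite fg //; lia.
Qed.

Lemma sopp_is_linear (T : {linear sser -> sser}) : linear (sopp T).
Proof.
move=> c f g; rewrite -[LHS]/(- T (c *: f + g)) linearP opprD -scalerN //.
Qed.
HB.instance Definition _ (T : {linear sser -> sser}) :=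
  GRing.isLinear.Build rat sser sser *:%R (sopp T) (sopp_is_linear T).

Lemma sopp_raising (T : sser -> sser) : raising T -> raising (sopp T).
Proof. by move=> hT f g r fg; apply: tserP => m; rewrite /sopp (hT f g). Qed.

Lemma iter_eq_le (T : sser -> sser) p f g r : raising T ->
  (forall q, (q <= r)%N -> f q = g q) -> iter p T f r = iter p T g r.
Proof.
move=> hT; elim: p r => [|p IHp] r fg /=; first exact: fg.
apply: hT => q qr; apply: IHp => q' qq'; apply: fg.
exact: leq_trans qq' (ltnW qr).
Qed.

Lemma iter_raising0 (T : {linear sser -> sser}) p s f r : raising T ->
  (forall q, (q < s)%N -> f q = 0) -> (r < p + s)%N -> iter p T f r = 0.
Proof.
move=> hT f0; elim: p r => [|p IHp] r rp /=; first exact: f0.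
by rewrite (hT _ 0) ?linear0 // => q qr; apply: IHp; lia.
Qed.

Lemma iter_linear (T : {linear sser -> sser}) p : linear (iter p T).
Proof. by move=> c f g; elim: p => //= p ->; rewrite linearP. Qed.
HB.instance Definition _ (T : {linear sser -> sser}) p :=
  GRing.isLinear.Build rat sser sser *:%R (iter p T) (iter_linear T p).

(** [sexp] cuts the exponential series at the order r of the coefficient. A cut at a fixed R gives
    the same result up to order R, because T^p raises the order by p, and it is an ordinary linear
    combination of iterates. *)
Definition expn_upto R (T : sser -> sser) (f : sser) : sser :=
  \sum_(p < R.+1) (p`!%:R)^-1 *: iter p T f.

Lemma sexpE R (T : {linear sser -> sser}) f r : raising T -> (r <= R)%N ->
  sexp T f r = expn_upto R T f r.
Proof.
move=> hT rR; apply: tserP => m; rewrite /sexp /expn_upto ssumE tsumE.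
rewrite (big_ord_widen R.+1 (fun p => (p`!%:R)^-1 * iter p T f r m)) //.
rewrite big_mkcond; apply: eq_bigr => p _; case: ifPn => //.
rewrite -leqNgt => rp; rewrite -[RHS]/((p`!%:R)^-1 * iter p T f r m).
by rewrite (@iter_raising0 _ _ 0) ?addn0 // mulr0.
Qed.

Lemma sexp_is_linear (T : {linear sser -> sser}) : linear (sexp T).
Proof.
move=> c f g; apply: sserP => r; apply: tserP => m.
rewrite -[RHS]/(c * sexp T f r m + sexp T g r m) /sexp mulr_sumr -big_split.
apply: eq_bigr => p _; rewrite linearP /=.
by rewrite -[in LHS]/(c * iter p T f r m + iter p T g r m) mulrDr mulrCA.
Qed.
HB.instance Definition _ (T : {linear sser -> sser}) :=
  GRing.isLinear.Build rat sser sser *:%R (sexp T) (sexp_is_linear T).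

Lemma sexp_eq_le (T : sser -> sser) f g r : raising T ->
  (forall q, (q <= r)%N -> f q = g q) -> sexp T f r = sexp T g r.
Proof.
move=> hT fg; apply: tserP => m; apply: eq_bigr => p _.
by rewrite (@iter_eq_le T p f g r).
Qed.

Lemma sum_triangle (V : nmodType) (X : nat -> nat -> V) r :
  \sum_(p < r.+1) \sum_(a < p.+1) X a (p - a)%N
  = \sum_(a < r.+1) \sum_(b < (r - a).+1) X a b.
Proof.
elim: r => [|r IHr]; first by rewrite !big_ord1.
rewrite big_ord_recr /= IHr [X in _ + X = _]big_ord_recr [RHS]big_ord_recr /=.
rewrite subnn big_ord1 addrA -big_split; congr (_ + _).
by apply: eq_bigr => a _ /=; rewrite subSn -1?ltnS // [RHS]big_ord_recr.
Qed.

(** The terms beyond the antidiagonal vanish, so the triangle may be completed to a square, over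
    which the two sums separate. *)
Lemma sum_triangle_square (V : nmodType) (X : nat -> nat -> V) r :
  (forall a b, (r < a + b)%N -> X a b = 0) ->
  \sum_(p < r.+1) \sum_(a < p.+1) X a (p - a)%N
  = \sum_(a < r.+1) \sum_(b < r.+1) X a b.
Proof.
move=> X0; rewrite sum_triangle; apply: eq_bigr => a _.
rewrite (big_ord_widen r.+1 (X a)) ?ltnS ?leq_subr // big_mkcond.
apply: eq_bigr => b _; case: ifPn => //; rewrite -leqNgt => ab.
by rewrite X0 //; have := ltn_ord a; lia.
Qed.

(** On the family w, T acts as the sum of two commuting operators, one raising a and one raising b;
    this is the binomial theorem, by Pascal's rule. *)
Lemma iter_leibniz (T : {linear sser -> sser}) (w : nat -> nat -> sser) p :
  (forall a b, T (w a b) = w a.+1 b + w a b.+1) ->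
  iter p T (w 0%N 0%N) = \sum_(a < p.+1) 'C(p, a)%:R *: w a (p - a)%N.
Proof.
move=> Tw; elim: p => [|p IHp]; first by rewrite big_ord1 bin0 scale1r.
rewrite iterS IHp linear_sum [RHS]big_ord_recl /= bin0 scale1r subn0.
under [LHS]eq_bigr => a _ do rewrite linearZ /= Tw scalerDr.
rewrite big_split /= addrC [X in X + _ = _]big_ord_recl /= bin0 scale1r subn0.
rewrite -addrA.
congr (_ + _).
under [RHS]eq_bigr => a _ do rewrite /bump /= add1n binS natrD scalerDl subSS.
rewrite big_split /=; congr (_ + _).
rewrite [RHS]big_ord_recr /= bin_small // scale0r addr0.
by apply: eq_bigr => a _; rewrite /bump /= add1n subnSK.
Qed.

(** Common source of three facts. Taking for w a b the product of T^a f and T^b g gives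
    multiplicativity of e^T; (-T)^a T^b f gives its inverse; the a-fold commutator applied to T^b f
    gives the conjugate of d/dt_d. *)
Lemma sexp_leibniz (T : {linear sser -> sser}) (w : nat -> nat -> sser) r :
  (forall a b, T (w a b) = w a.+1 b + w a b.+1) ->
  (forall a b, (r < a + b)%N -> w a b r = 0) ->
  sexp T (w 0%N 0%N) r = \sum_(a < r.+1) \sum_(b < r.+1)
    ((a`!%:R)^-1 * (b`!%:R)^-1) *: w a b r.
Proof.
move=> Tw w0.
rewrite -(@sum_triangle_square _ (fun a b =>
  ((a`!%:R)^-1 * (b`!%:R)^-1) *: w a b r)); last first.
  by move=> a b ab; rewrite w0 // scaler0.
apply: tserP => m; rewrite /sexp tsumE; apply: eq_bigr => p _.
rewrite (iter_leibniz _ Tw) ssumE !tsumE mulr_sumr; apply: eq_bigr => a _.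
rewrite -![(_ *: _ : sser) r m]/(_ * w a (p - a)%N r m) tscaleE mulrA.
congr (_ * _).
have ap : (a <= p)%N by rewrite -ltnS.
rewrite -(bin_fact ap) !natrM !invfM mulrAC mulVf ?mul1r //.
by rewrite pnatr_eq0 -lt0n bin_gt0.
Qed.

Lemma sexp_smul (T : {linear sser -> sser}) f g : raising T ->
  (forall f g, T (smul f g) = smul (T f) g + smul f (T g)) ->
  sexp T (smul f g) = smul (sexp T f) (sexp T g).
Proof.
move=> hT Tder; apply: sserP => r.
rewrite (@sexp_leibniz T (fun a b => smul (iter a T f) (iter b T g))) //.
- rewrite (@smul_eq_le _ (expn_upto r T f) _ (expn_upto r T g)); last first.
  + by move=> q; exact: sexpE.
  + by move=> q; exact: sexpE.
  rewrite smul_suml ssumE; apply: eq_bigr => a _.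
  rewrite smulZl linear_sum scaler_sumr ssumE; apply: eq_bigr => b _.
  by rewrite linearZ /= scalerA.
(* Either q < a or r - q < b, so one of the two factors vanishes. *)
move=> a b ab; rewrite smulE big1 // => q _.
have [qa|aq] := ltnP q a; first by rewrite (@iter_raising0 _ a 0) ?addn0 // tmulC linear0.
by rewrite (@iter_raising0 _ b 0) ?linear0 //; have := ltn_ord q; lia.
Qed.

Lemma sexp_opp (T : {linear sser -> sser}) f : raising T ->
  sexp (sopp T) (sexp T f) = f.
Proof.
move=> hT; apply: sserP => r; have hS := sopp_raising hT.
have TS a x : iter a (sopp T) (T x) = T (iter a (sopp T) x).
  by elim: a => //= a ->; rewrite -[in RHS]/(- _) linearN.
rewrite (sexpE _ hS (leqnn r)).
rewrite (_ : expn_upto r (sopp T) _ r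
           = expn_upto r (sopp T) (expn_upto r T f) r); last first.
  rewrite /expn_upto !ssumE; apply: eq_bigr => a _.
  congr (_ *: _); apply: iter_eq_le => // q; exact: sexpE.
pose w a b := iter a (sopp T) (iter b T f).
(* For w a b = (-T)^a T^b f the two neighbours in the Leibniz relation cancel. The double sum is
   therefore the exponential of the zero operator, applied to f. *)
pose Z : {linear sser -> sser} := \0.
transitivity (sexp Z (w 0%N 0%N) r); last first.
  apply: tserP => m; rewrite /sexp big_ord_recl big1 ?addr0 ?mul1r //.
  by move=> i _; rewrite mulr0.
rewrite (@sexp_leibniz Z w).
- rewrite [in LHS]/expn_upto ssumE; apply: eq_bigr => a _.
  rewrite linear_sum scaler_sumr ssumE; apply: eq_bigr => b _.
  by rewrite linearZ /= scalerA.
- by move=> a b; rewrite /w /= TS addNr.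
move=> a b ab; rewrite /w.
apply: (@iter_raising0 _ _ b) => // q qb.
by apply: (@iter_raising0 _ _ 0); rewrite ?addn0.
Qed.

Lemma iter_shift (T : sser -> sser) p e f :
  (forall f, T (shift e f) = shift e (T f)) ->
  iter p T (shift e f) = shift e (iter p T f).
Proof. by move=> Te; elim: p => //= p ->. Qed.

Lemma sexp_shift (T : {linear sser -> sser}) e f : raising T ->
  (forall f, T (shift e f) = shift e (T f)) ->
  sexp T (shift e f) = shift e (sexp T f).
Proof.
move=> hT Te; apply: sserP => r; rewrite (sexpE _ hT (leqnn r)).
transitivity (shift e (expn_upto r T f) r).
  rewrite /expn_upto linear_sum; congr ((_ : sser) r); apply: eq_bigr => p _.
  by rewrite iter_shift // linearZ.
by rewrite /shift; case: ifP => // _; rewrite -sexpE // leq_subr.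
Qed.

Lemma soneE r : sone r = (r == 0%N)%:R *: tone.
Proof. by []. Qed.

Lemma lop_sone alpha : lop alpha sone = 0.
Proof.
apply: sserP => r; rewrite (lopE _ _ (ltnSn _)) big1_seq // => k _.
apply: sserP => q; rewrite /shift; case: ifP => // _.
rewrite /lcs soneE linearZ /=.
rewrite (_ : lcoef _ _ _ = 0) ?scaler0 //.
apply: tserP => m; rewrite (lcoefE _ _ _ (leqnn _)) big1 // => n _.
by rewrite tpart_tone linear0 scaler0.
Qed.

Lemma sexp_sone (T : {linear sser -> sser}) : T sone = 0 -> sexp T sone = sone.
Proof.
move=> T1; apply: sserP => r; apply: tserP => m.
rewrite /sexp big_ord_recl big1 ?addr0 ?mul1r // => p _.
by rewrite iterSr T1 linear0 mulr0.
Qed.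

(** * Conjugation of the derivatives d/dt_d *)

Definition spart d (f : sser) : sser := fun r => tpart d (f r).

Lemma spart_is_linear d : linear (spart d).
Proof.
move=> c f g; apply: sserP => r; exact: (tpart_is_linear d c (f r) (g r)).
Qed.
HB.instance Definition _ d :=
  GRing.isLinear.Build rat sser sser *:%R (spart d) (spart_is_linear d).

Lemma spart_shift d e f : spart d (shift e f) = shift e (spart d f).
Proof.
by apply: sserP => r; rewrite /spart /shift; case: ifP => // _; rewrite linear0.
Qed.

(* The a-fold commutator of sopp (lop alpha) with d/dt_d, which is again an
   operator with constant coefficients. *)
Fixpoint adpart alpha (a d : nat) (f : sser) : sser :=
  if a is a'.+1 then
    fun r => \sum_(1 <= k < r./2.+1)
      alpha d (d + k)%N *: adpart alpha a' (d + k) f (r - k.*2)%N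
  else spart d f.

Lemma adpartS alpha a d f r K : (r./2 < K)%N ->
  adpart alpha a.+1 d f r = (\sum_(1 <= k < K)
    alpha d (d + k)%N *: shift k.*2 (adpart alpha a (d + k) f)) r.
Proof.
move=> rK; rewrite ssumE /=.
rewrite [RHS](@big_cat_nat _ _ _ r./2.+1) //=.
rewrite [X in _ = _ + X](_ : _ = 0) ?addr0; last first.
  rewrite big_nat big1 // => k /andP[kr _].
  rewrite -[LHS]/(alpha d (d + k)%N *: shift k.*2 (adpart alpha a (d + k) f) r).
  by rewrite /shift ifF ?scaler0 //; apply/negbTE; lia.
apply: eq_big_nat => k /andP[_ kr].
rewrite -[RHS]/(alpha d (d + k)%N *: shift k.*2 (adpart alpha a (d + k) f) r).
by rewrite /shift ifT //; lia.
Qed.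

Lemma adpart_is_linear alpha a d : linear (adpart alpha a d).
Proof.
elim: a d => [|a IHa] d c f g; first exact: spart_is_linear.
apply: sserP => r.
rewrite -[RHS]/(c *: adpart alpha a.+1 d f r + adpart alpha a.+1 d g r) /=.
rewrite scaler_sumr -big_split; apply: eq_bigr => k _; rewrite IHa /=.
rewrite -[(_ *: _ + _ : sser) _]/(c *: adpart alpha a (d + k) f (r - k.*2)%N
   + adpart alpha a (d + k) g (r - k.*2)%N).
by rewrite scalerDr !scalerA mulrC.
Qed.
HB.instance Definition _ alpha a d :=
  GRing.isLinear.Build rat sser sser *:%R (adpart alpha a d)
    (adpart_is_linear alpha a d).

Lemma adpart_eq_le alpha a d f g r : (forall q, (q <= r)%N -> f q = g q) ->
  adpart alpha a d f r = adpart alpha a d g r.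
Proof.
elim: a d r => [|a IHa] d r fg; first by rewrite /= /spart fg.
apply: eq_bigr => k _; congr (_ *: _); apply: IHa => q qr; apply: fg.
exact: leq_trans qr (leq_subr _ _).
Qed.

Lemma adpart_raising0 alpha a d f s r : (forall q, (q < s)%N -> f q = 0) ->
  (r < a + s)%N -> adpart alpha a d f r = 0.
Proof.
move=> f0; elim: a d r => [|a IHa] d r rs.
  by rewrite /= /spart f0 // linear0.
rewrite /= big_nat big1 // => k /andP[k1 kr].
by rewrite IHa ?scaler0 //; lia.
Qed.

(** The minus sign turns the commutator of l with d/dt_d into the one computed by [tpart_lcoef];
    hence no sign enters [adpart]. *)
Lemma lop_spart alpha d f :
  sopp (lop alpha) (spart d f)
  = spart d (sopp (lop alpha) f) + adpart alpha 1 d f.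
Proof.
apply: sserP => r.
rewrite -[RHS]/(tpart d (- lop alpha f r) + adpart alpha 1 d f r).
rewrite -[LHS]/(- lop alpha (spart d f) r).
suff E : tpart d (lop alpha f r)
    = lop alpha (spart d f) r + adpart alpha 1 d f r.
  by rewrite -[LHS](subrK (adpart alpha 1 d f r)) -opprD -E -linearN.
rewrite (adpartS _ _ _ _ (ltnSn _)).
rewrite !(lopE _ _ (ltnSn _)) -[tpart d _]/(spart d _ r).
rewrite -[RHS]/((_ + _ : sser) r); congr ((_ : sser) r).
rewrite linear_sum -big_split; apply: eq_bigr => k _ /=.
rewrite spart_shift -linearZ -linearD; congr shift.
apply: sserP => q; rewrite -[spart d (lcs _ _ _) q]/(tpart d (lcoef _ _ _)).
by rewrite tpart_lcoef.
Qed.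

Lemma sopp_lop_shift alpha e f :
  sopp (lop alpha) (shift e f) = shift e (sopp (lop alpha) f).
Proof.
by rewrite -[LHS]/(- lop alpha (shift e f)) lop_shift -linearN.
Qed.

Lemma sopp_lop_raising alpha : raising (sopp (lop alpha)).
Proof. exact/sopp_raising/lop_raising. Qed.

Lemma lop_adpart alpha a d f :
  sopp (lop alpha) (adpart alpha a d f)
  = adpart alpha a.+1 d f + adpart alpha a d (sopp (lop alpha) f).
Proof.
elim: a d => [|a IHa] d; first by rewrite lop_spart addrC.
(* As -l raises the order, only coefficients below r matter, and for these the sum over k can be
   given the fixed range k <= r./2. *)
apply: sserP => r; rewrite (@sopp_lop_raising alpha _ (\sum_(1 <= k < r./2.+1)
    alpha d (d + k)%N *: shift k.*2 (adpart alpha a (d + k) f))); last first.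
  by move=> q qr; apply: adpartS; lia.
rewrite -[RHS]/(adpart alpha a.+2 d f r
  + adpart alpha a.+1 d (sopp (lop alpha) f) r).
rewrite !(adpartS _ _ _ _ (ltnSn _)).
rewrite -[RHS]/((_ + _ : sser) r); congr ((_ : sser) r).
rewrite linear_sum -big_split; apply: eq_bigr => k _ /=.
by rewrite linearZ /= sopp_lop_shift IHa linearD scalerDr.
Qed.

(** This is e^T X e^(-T) = e^(ad T) X with T = -l and X = d/dt_d, applied to e^T f. The terms a > r
    drop out since the a-fold commutator raises the order by at least a. *)
Lemma sexp_spart alpha d f r :
  sexp (sopp (lop alpha)) (spart d f) r
  = \sum_(a < r.+1) (a`!%:R)^-1 *:
      adpart alpha a d (sexp (sopp (lop alpha)) f) r.
Proof.
have hT := @sopp_lop_raising alpha.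
rewrite (@sexp_leibniz _
  (fun a b => adpart alpha a d (iter b (sopp (lop alpha)) f))) //.
- apply: eq_bigr => a _.
  rewrite (@adpart_eq_le _ _ _ (sexp _ _) (expn_upto r (sopp (lop alpha)) f)).
    rewrite linear_sum ssumE scaler_sumr; apply: eq_bigr => b _.
    by rewrite linearZ /= -scalerA.
  by move=> q; exact: sexpE.
- by move=> a b; exact: lop_adpart.
move=> a b ab; apply: (@adpart_raising0 _ _ _ _ b) => // q qb.
by apply: (@iter_raising0 _ _ 0); rewrite ?addn0.
Qed.

(** * Differential polynomials in the unknowns *)

Definition is_diffpoly (Phi : (nat -> tser) -> tser) : Prop :=
  exists P, forall F, Phi F = deval P F.

Lemma devalE P F :
  deval P F = \sum_(c <- P) c.1 *: (\big[tmul/tone]_(u <- c.2) tparts u.2 (F u.1)).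
Proof. by apply: tserP => m; rewrite tsumE. Qed.

Lemma is_diffpoly0 : is_diffpoly (fun=> 0).
Proof. by exists [::] => F; rewrite devalE big_nil. Qed.

Lemma is_diffpolyD Phi Psi : is_diffpoly Phi -> is_diffpoly Psi ->
  is_diffpoly (fun F => Phi F + Psi F).
Proof.
by move=> [P hP] [Q hQ]; exists (P ++ Q) => F; rewrite devalE big_cat hP hQ !devalE.
Qed.

Lemma is_diffpolyZ c Phi : is_diffpoly Phi -> is_diffpoly (fun F => c *: Phi F).
Proof.
move=> [P hP]; exists [seq (c * a.1, a.2) | a <- P] => F.
rewrite devalE big_map hP devalE scaler_sumr; apply: eq_bigr => a _.
by rewrite scalerA.
Qed.

Lemma is_diffpoly_sum I (s : seq I) P (Phi : I -> (nat -> tser) -> tser) :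
  (forall i, is_diffpoly (Phi i)) ->
  is_diffpoly (fun F => \sum_(i <- s | P i) Phi i F).
Proof.
move=> h; elim: s => [|i s [Q hQ]].
  by exists [::] => F; rewrite devalE !big_nil.
case: (boolP (P i)) => Pi; last first.
  by exists Q => F; rewrite big_cons (negPf Pi).
have [R hR] : is_diffpoly (fun F => Phi i F + \sum_(i <- s | P i) Phi i F).
  by apply: is_diffpolyD => //; exists Q.
by exists R => F; rewrite big_cons Pi hR.
Qed.

Lemma is_diffpoly_mono us :
  is_diffpoly (fun F => \big[tmul/tone]_(u <- us) tparts u.2 (F u.1)).
Proof. by exists [:: (1, us)] => F; rewrite devalE big_seq1 scale1r. Qed.

Lemma is_diffpolyM Phi Psi : is_diffpoly Phi -> is_diffpoly Psi ->
  is_diffpoly (fun F => tmul (Phi F) (Psi F)).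
Proof.
move=> [P hP] [Q hQ].
have [R hR] : is_diffpoly (fun F => \sum_(a <- P) \sum_(b <- Q) (a.1 * b.1) *:
    \big[tmul/tone]_(u <- a.2 ++ b.2) tparts u.2 (F u.1)).
  apply: is_diffpoly_sum => a; apply: is_diffpoly_sum => b.
  exact/is_diffpolyZ/is_diffpoly_mono.
exists R => F; rewrite -hR hP hQ !devalE tmul_suml; apply: eq_bigr => a _.
rewrite linear_sum; apply: eq_bigr => b _.
by rewrite /= tmulZl tmulZr scalerA big_cat.
Qed.

Lemma is_diffpoly_tpart d Phi : is_diffpoly Phi ->
  is_diffpoly (fun F => tpart d (Phi F)).
Proof.
move=> [P hP].
have mono us : is_diffpoly (fun F =>
    tpart d (\big[tmul/tone]_(u <- us) tparts u.2 (F u.1))).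
  elim: us => [|u us IHus].
    by exists [::] => F; rewrite devalE !big_nil tpart_tone.
  (* Leibniz rule, with the first factor and its derivative written as monomials of length one. *)
  have [R hR] : is_diffpoly (fun F =>
      tmul (\big[tmul/tone]_(u <- [:: (u.1, d :: u.2)]) tparts u.2 (F u.1))
           (\big[tmul/tone]_(u <- us) tparts u.2 (F u.1))
      + tmul (\big[tmul/tone]_(u <- [:: u]) tparts u.2 (F u.1))
             (tpart d (\big[tmul/tone]_(u <- us) tparts u.2 (F u.1)))).
    apply: is_diffpolyD; apply: is_diffpolyM => //; exact: is_diffpoly_mono.
  by exists R => F; rewrite -hR !big_seq1 big_cons tpart_tmul.
have [R hR] : is_diffpoly (fun F => \sum_(a <- P) a.1 *:
    tpart d (\big[tmul/tone]_(u <- a.2) tparts u.2 (F u.1))).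
  by apply: is_diffpoly_sum => a; apply: is_diffpolyZ.
exists R => F; rewrite -hR hP devalE linear_sum; apply: eq_bigr => a _.
by rewrite linearZ.
Qed.

Lemma is_diffpoly_adpart alpha a d (Phi : (nat -> tser) -> sser) :
  (forall r, is_diffpoly (fun F => Phi F r)) ->
  forall r, is_diffpoly (fun F => adpart alpha a d (Phi F) r).
Proof.
move=> h; elim: a d => [|a IHa] d r; first exact: is_diffpoly_tpart.
apply: is_diffpoly_sum => k; exact/is_diffpolyZ/IHa.
Qed.

(** * Properties preserved by the operations that build the equation *)

Record diffop_closed D I (Good : (I -> sser) -> Prop) : Prop := DiffopClosed {
  closedD : forall Phi Psi, Good Phi -> Good Psi ->
    Good (fun x => Phi x + Psi x);
  closedZ : forall (c : rat) Phi, Good Phi -> Good (fun x => c *: Phi x);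
  closedM : forall Phi Psi, Good Phi -> Good Psi ->
    Good (fun x => smul (Phi x) (Psi x));
  closed1 : Good (fun=> sone);
  closed_shift : forall e Phi, Good Phi -> Good (fun x => shift e (Phi x));
  closed_spart : forall d Phi, (d < D)%N -> Good Phi ->
    Good (fun x => spart d (Phi x))
}.

Lemma closed0 D I (Good : (I -> sser) -> Prop) :
  diffop_closed D Good -> Good (fun=> 0).
Proof.
move=> hG; rewrite (_ : (fun=> 0) = fun=> 0 *: sone).
  exact: (closedZ hG) (closed1 hG).
by apply: funext => x; rewrite scale0r.
Qed.

Lemma closed_sum D I (Good : (I -> sser) -> Prop) (K : eqType) (s : seq K)
    (P : pred K) (Phi : K -> I -> sser) : diffop_closed D Good ->
  (forall k, k \in s -> P k -> Good (Phi k)) ->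
  Good (fun x => \sum_(k <- s | P k) Phi k x).
Proof.
move=> hG; elim: s => [|k s IHs] h.
  rewrite (_ : (fun _ => _) = fun=> 0); first exact: closed0 hG.
  by apply: funext => x; rewrite big_nil.
have {}IHs : Good (fun x => \sum_(k <- s | P k) Phi k x).
  by apply: IHs => k' k's; apply: h; rewrite in_cons k's orbT.
case: (boolP (P k)) => Pk; last first.
  rewrite (_ : (fun _ => _) = fun x => \sum_(k <- s | P k) Phi k x) //.
  by apply: funext => x; rewrite big_cons (negPf Pk).
rewrite (_ : (fun _ => _) = fun x => Phi k x + \sum_(k <- s | P k) Phi k x).
  by apply: (closedD hG) => //; apply: h => //; rewrite mem_head.
by apply: funext => x; rewrite big_cons Pk.
Qed.

Lemma closed_prod D I (Good : (I -> sser) -> Prop) (K : eqType) (s : seq K)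
    (Phi : K -> I -> sser) : diffop_closed D Good ->
  (forall k, k \in s -> Good (Phi k)) ->
  Good (fun x => \big[smul/sone]_(k <- s) Phi k x).
Proof.
move=> hG; elim: s => [|k s IHs] h.
  rewrite (_ : (fun _ => _) = fun=> sone); first exact: closed1 hG.
  by apply: funext => x; rewrite big_nil.
rewrite (_ : (fun _ => _) =
    fun x => smul (Phi k x) (\big[smul/sone]_(k <- s) Phi k x)).
  apply: (closedM hG); first by apply: h; rewrite mem_head.
  by apply: IHs => k' k's; apply: h; rewrite in_cons k's orbT.
by apply: funext => x; rewrite big_cons.
Qed.

Lemma ppartE b G :
  ppart b G = \sum_(d < b) ((b ^ b.-1)%:R / ((b - d.+1)`!)%:R) *:
                shift (3 * b + (2 * d + 1)) (spart d G).
Proof.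
apply: sserP => r; apply: tserP => m; rewrite ssumE tsumE /ppart big_mkcond.
apply: eq_bigr => d _; set e := (3 * b + _)%N; set c := _ / _.
rewrite -[RHS]/(c * shift e (spart d G) r m) /shift.
by case: ifP => // _; rewrite mulr0.
Qed.

Lemma unst_jetE b1 b2 :
  unst_jet [:: b1; b2] =
  ((b1 ^ b1 * b2 ^ b2)%:R / ((b1 + b2) * (b1`! * b2`!))%:R)
    *: shift (3 * (b1 + b2)) sone.
Proof.
apply: sserP => r; apply: tserP => m; rewrite /unst_jet; set c := _ / _.
set e := (3 * _)%N; rewrite -[RHS]/(c * shift e sone r m) /shift [RHS]mulrC.
congr (_ * _); case: (ltngtP e r) => er /=.
- by rewrite /sone subn_eq0 leqNgt er.
- by rewrite mul0r.
- by rewrite er /sone subnn.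
Qed.

(** Serves to bound the indices b of the derivatives d/dp_b that occur in the equation by the parts
    of the partitions. *)
Lemma mem_setparts s pi B : pi \in setparts s -> B \in pi -> {subset B <= s}.
Proof.
elim: s pi B => [|x s IHs] pi B /=; first by rewrite inE => /eqP ->.
have ins q pi' : pi' \in insert_each x q ->
    B \in pi' -> B \in q \/ exists2 B', B' \in q & B = x :: B'.
  elim: q pi' => [|B0 q IHq] pi' //=.
  rewrite in_cons => /orP[/eqP ->|/mapP[q' qq' ->]].
    rewrite in_cons => /orP[/eqP ->|Bq]; last by left; rewrite in_cons Bq orbT.
    by right; exists B0 => //; rewrite mem_head.
  rewrite in_cons => /orP[/eqP ->|/(IHq _ qq')]; first by left; rewrite mem_head.
  move=> [Bq|[B' B'q ->]]; first by left; rewrite in_cons Bq orbT.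
  by right; exists B' => //; rewrite in_cons B'q orbT.
move=> /flatten_mapP[q qs]; rewrite in_cons => /orP[/eqP ->|piq].
  rewrite in_cons => /orP[/eqP ->|Bq] b; first by rewrite inE => /eqP ->; rewrite mem_head.
  by move=> /(IHs _ _ qs Bq) bs; rewrite in_cons bs orbT.
move=> /(ins _ _ piq)[Bq|[B' B'q ->]] b.
  by move=> /(IHs _ _ qs Bq) bs; rewrite in_cons bs orbT.
rewrite !in_cons => /orP[->//|/(IHs _ _ qs B'q) ->]; exact: orbT.
Qed.

Lemma expjetE J la :
  expjet J la = \sum_(pi <- setparts la) \big[smul/sone]_(B <- pi) J B.
Proof. by apply: sserP => r; apply: tserP => m; rewrite ssumE tsumE. Qed.

Lemma DjetE J mu : Djet J mu =
  \sum_(p < (sumn mu).+1)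
    \sum_(la : p.-tuple 'I_(sumn mu).+1 | is_partition (sumn mu) (map val la))
      (chi mu (map val la) / (aut_size (map val la))%:R)
        *: expjet J (map val la).
Proof.
apply: sserP => r; apply: tserP => m; rewrite ssumE tsumE.
by apply: eq_bigr => p _; rewrite ssumE tsumE.
Qed.

Lemma KPjetE i j J : KPjet i j J =
  smul (Djet J [::]) (Djet J [:: j; i])
  + (-1) *: smul (Djet J [:: i.-1]) (Djet J [:: j; 1%N])
  + smul (Djet J [:: j]) (Djet J [:: i.-1; 1%N]).
Proof.
by rewrite scaleN1r; apply: sserP => r; apply: tserP => m; rewrite /KPjet.
Qed.

Lemma closed_Djet D I (Good : (I -> sser) -> Prop) (J : I -> seq nat -> sser) mu :
  diffop_closed D Good -> (sumn mu <= D)%N ->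
  (forall B, {in B, forall b, (b <= D)%N} -> Good (fun x => J x B)) ->
  Good (fun x => Djet (J x) mu).
Proof.
move=> hG muD hJ; under eq_fun => x do rewrite DjetE.
apply: (closed_sum hG) => p _ _; apply: (closed_sum hG) => la _ _.
apply: (closedZ hG); under eq_fun => x do rewrite expjetE.
apply: (closed_sum hG) => pi pila _; apply: (closed_prod hG) => B Bpi.
apply: hJ => b /(mem_setparts pila Bpi) /mapP[k _ ->].
by apply: leq_trans muD; rewrite -ltnS; exact: ltn_ord.
Qed.

(** An induction principle: what is preserved by sums, products, shifts and the d/dt_d with d < D
    passes from the argument to the equation. All partitions in it have size at most i + j, and
    d/dp_b involves only d < b, so t_D is never differentiated. It is applied to [subst_var],
    [eqmod_var] and [conj_diffpoly]. *)
Lemma closed_KPtrans D I (Good : (I -> sser) -> Prop) i j (Phi : I -> sser) :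
  diffop_closed D Good -> (2 <= i)%N -> (i + j <= D)%N -> Good Phi ->
  Good (fun x => KPtrans i j (Phi x)).
Proof.
move=> hG i2 ijD hPhi.
have hpart b Psi : (b <= D)%N -> Good Psi -> Good (fun x => ppart b (Psi x)).
  move=> bD hPsi; under eq_fun => x do rewrite ppartE.
  apply: (closed_sum hG) => d _ _; apply: (closedZ hG).
  apply: (closed_shift hG).
  by apply: (closed_spart hG) => //; exact: leq_trans bD.
have hJ B : {in B, forall b, (b <= D)%N} -> Good (fun x r m =>
    if (size B < 2)%N then 0 else pparts B (Phi x) r m + unst_jet B r m).
  move=> BD; case: (size B < 2)%N; first exact: closed0 hG.
  apply: (closedD hG (Phi := fun x => pparts B (Phi x))
                     (Psi := fun=> unst_jet B)).
    elim: B BD => // b B IHB BD /=; apply: hpart; first by apply: BD; rewrite mem_head.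
    by apply: IHB => b' b'B; apply: BD; rewrite in_cons b'B orbT.
  (* Only words of length two have an unstable contribution, a constant times a power of s. *)
  case: B BD => [|b1 [|b2 [|b3 B]]] _; try exact: closed0 hG.
  rewrite unst_jetE.
  apply: (closedZ hG); apply: (closed_shift hG); exact: closed1 hG.
rewrite /KPtrans; under eq_fun => x do rewrite KPjetE.
have hD mu : (sumn mu <= D)%N -> Good (fun x => Djet (fun B r m =>
    if (size B < 2)%N then 0 else pparts B (Phi x) r m + unst_jet B r m) mu).
  by move=> muD; exact: closed_Djet hG muD hJ.
apply: (closedD hG); first apply: (closedD hG); last first.
- by apply: (closedM hG); apply: hD => /=; lia.
- by apply: (closedZ hG); apply: (closedM hG); apply: hD => /=; lia.
- by apply: (closedM hG); apply: hD => /=; lia.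
Qed.

(** * Dependence of the divided equation on its argument, order by order *)

Lemma sum_triangle3 (V : nmodType) (X : nat -> nat -> nat -> V) r :
  \sum_(e < r.+1) \sum_(q < e.+1) X q (e - q)%N (r - e)%N
  = \sum_(q < r.+1) \sum_(j < (r - q).+1) X q j (r - q - j)%N.
Proof.
rewrite -(sum_triangle (fun q j => X q j (r - q - j)%N)).
apply: eq_bigr => e _; apply: eq_bigr => q _; congr X.
by have := ltn_ord q; lia.
Qed.

Lemma sum_triangle_swap (V : nmodType) (Y : nat -> nat -> nat -> V) n :
  \sum_(j < n.+1) \sum_(a < (n - j).+1) Y j a (n - j - a)%N
  = \sum_(a < n.+1) \sum_(j < (n - a).+1) Y j a (n - a - j)%N.
Proof.
rewrite -sum_triangle3 -(sum_triangle3 (fun a j => Y j a)).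
apply: eq_bigr => p _; rewrite (reindex_inj rev_ord_inj).
by apply: eq_bigr => a _ /=; rewrite subSS subKn // -ltnS.
Qed.

Lemma msetn_subst_sub D (m x : {mset nat}) c a :
  m D = 0%N -> x `<=` m -> (a <= c)%N ->
  (m `+` msetn c D) `\` (x `+` msetn a D)
  = (m `\` x) `+` msetn (c - a)%N D :> {mset nat}.
Proof.
move=> mD /msubsetP xm ac; apply/msetP => e; rewrite !(msetE2, msetnE).
by have := xm e; case: eqP => [->|_]; rewrite ?mD; lia.
Qed.

(** As t_D does not divide m, a divisor of m t_D^c is in a unique way a divisor x of m times t_D^a
    with a <= c. *)
Lemma tmul_subst D (m : {mset nat}) c f g : m D = 0%N ->
  tmul f g (m `+` msetn c D) = \sum_(a < c.+1) \sum_(x <- submsets m)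
    f (x `+` msetn a D) * g ((m `\` x) `+` msetn (c - a)%N D).
Proof.
move=> mD.
have xD (x : {mset nat}) : x \in submsets m -> x D = 0%N.
  by rewrite mem_submsets => /msubsetP/(_ D); rewrite mD leqn0 => /eqP.
rewrite /tmul (perm_big [seq x `+` msetn a D | a <- iota 0 c.+1, x <- submsets m]).
  rewrite big_allpairs_dep -(big_mkord xpredT (fun a => \sum_(x <- submsets m)
    f (x `+` msetn a D) * g ((m `\` x) `+` msetn (c - a)%N D))).
  rewrite /index_iota subn0; apply: eq_big_seq => a.
  rewrite mem_iota add0n ltnS => /andP[_ ac]; apply: eq_big_seq => x.
  by rewrite mem_submsets => xm; rewrite msetn_subst_sub.
apply: uniq_perm; first exact: submsets_uniq.
  apply: allpairs_uniq; [exact: iota_uniq|exact: submsets_uniq|].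
  move=> [a x] [b y] /allpairsP[[a' x'] [_ xs [-> ->]]].
  move=> /allpairsP[[b' y'] [_ ys [-> ->]]] /= e; rewrite /= in xs ys.
  have ab : a' = b'.
    have /(congr1 (fun s : {mset nat} => s D)) := e.
    by rewrite !msetE2 !msetnxx !xD.
  by rewrite ab in e *; rewrite -[x'](msetDKBC (msetn b' D)) e msetDKBC.
move=> y; rewrite mem_submsets; apply/idP/allpairsP => [ym|].
  exists (y D, y `\` msetn (y D) D); split.
  - have := msubsetP ym D; rewrite msetE2 msetnxx mD mem_iota /=; lia.
  - rewrite mem_submsets; apply/msubsetP => e; have := msubsetP ym e.
    by rewrite !(msetE2, msetnE) /=; case: eqP => [->|]; lia.
  - by apply/msetP => e; rewrite !(msetE2, msetnE) /=; case: eqP => [->|]; lia.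
move=> [[a x]]; rewrite mem_iota mem_submsets /= => -[ac /msubsetP xm ->].
apply/msubsetP => e; rewrite !(msetE2, msetnE); have := xm e.
by case: eqP; lia.
Qed.

(* Congruence modulo t_D ^ R.+1. *)
Definition eqmod_var D R (Phi : bool -> sser) : Prop :=
  forall r (m : {mset nat}), (m D <= R)%N -> Phi true r m = Phi false r m.

(* Phi false is obtained from Phi true by substituting s for t_D, as far as
   coefficients without t_D are concerned. *)
Definition subst_var D (Phi : bool -> sser) : Prop :=
  forall r (m : {mset nat}), m D = 0%N ->
    Phi false r m = \sum_(e < r.+1) Phi true e (m `+` msetn (r - e)%N D).

Lemma eqmod_var_closed D R : diffop_closed D (eqmod_var D R).
Proof.
split.
- move=> Phi Psi h1 h2 r m mD; have E b : (Phi b + Psi b) r m =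
    Phi b r m + Psi b r m by []; by rewrite !E h1 // h2.
- move=> c Phi h r m mD; have E b : (c *: Phi b) r m = c * Phi b r m by [].
  by rewrite !E h.
- move=> Phi Psi h1 h2 r m mD; apply: eq_bigr => q _.
  have le a : a `<=` m -> (a D <= R)%N.
    by move=> /msubsetP am; exact: leq_trans (am D) mD.
  by apply: tmul_eq_le => a /le aD; [exact: h1|exact: h2].
- by [].
- by move=> e Phi h r m mD; rewrite /shift; case: ifP => // _; exact: h.
(* Since d < D, the derivative does not change the exponent of t_D. *)
move=> d Phi dD h r m mD; rewrite /spart /tpart h // mset1DE.
by rewrite gtn_eqF.
Qed.

Lemma subst_var_closed D : diffop_closed D (subst_var D).
Proof.
split.
- move=> Phi Psi h1 h2 r m mD; have E b q n : (Phi b + Psi b) q n =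
    Phi b q n + Psi b q n by [].
  by rewrite E h1 // h2 // -big_split.
- move=> c Phi h r m mD.
  have E b q n : (c *: Phi b) q n = c * Phi b q n by [].
  by rewrite E h // mulr_sumr.
- move=> Phi Psi h1 h2 r m mD.
  (* The contribution of s^q t_D^a in the first factor and s^j t_D^b in the second. Both sides sum
     it over q + a + j + b = r: the left side groups by q + a, since it substitutes before
     multiplying, the right side by q + j. *)
  pose B q a j b := \sum_(x <- submsets m) Phi true q (x `+` msetn a D) *
    Psi true j ((m `\` x) `+` msetn b D).
  transitivity (\sum_(q < r.+1) \sum_(e < q.+1) \sum_(j < (r - q).+1)
      B e (q - e)%N j (r - q - j)%N).
    apply: eq_bigr => q _; rewrite /tmul exchange_big /=.
    under [RHS]eq_bigr => j _ do rewrite exchange_big /=.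
    rewrite [RHS]exchange_big /=; apply: eq_big_seq => x.
    rewrite mem_submsets => /msubsetP/(_ D); rewrite mD leqn0 => /eqP xD.
    have mxD : (m `\` x) D = 0%N by rewrite msetE2 mD.
    by rewrite h1 // h2 // mulr_suml exchange_big; apply: eq_bigr => e _;
       rewrite mulr_sumr.
  rewrite (sum_triangle3 (fun e a n => \sum_(j < n.+1) B e a j (n - j)%N)).
  under eq_bigr => q _ do
    rewrite (sum_triangle_swap (fun a j b => B q a j b)).
  rewrite -(sum_triangle3 (fun q j n => \sum_(a < n.+1) B q a j (n - a)%N)).
  apply: eq_bigr => e _; rewrite /smul; apply: eq_bigr => q _.
  by rewrite tmul_subst.
(* Only e = 0 contributes, and m t_D^r is the monomial 1 exactly when m is empty and r = 0. *)
- move=> r m mD; rewrite /sone big_ord_recl big1 /= ?addr0 ?mul1r; last first.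
    by move=> i _; rewrite mul0r.
  rewrite /tone subn0 -natrM mulnb; congr (_%:R); congr nat_of_bool.
  apply/andP/eqP => [[/eqP -> /eqP ->]|e]; first by rewrite msetn0 mset0D.
  have := congr1 (fun s : {mset nat} => s D) e.
  rewrite msetE2 msetnxx mD mset0E add0n => r0; split; first by apply/eqP.
  by apply/eqP; rewrite -e r0 msetn0 msetD0.
- move=> e Phi h r m mD; rewrite /shift.
  rewrite -(big_mkord xpredT (fun q => (if (e <= q)%N
    then Phi true (q - e)%N else 0) (m `+` msetn (r - q)%N D))).
  have zero a b : (b <= e)%N -> \sum_(a <= q < b) (if (e <= q)%N
      then Phi true (q - e)%N else 0) (m `+` msetn (r - q)%N D) = 0.
    move=> be; rewrite big_nat big1 // => q /andP[_ qb].
    by rewrite leqNgt (leq_trans qb be).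
  case: leqP => er; last by rewrite zero.
  rewrite (@big_cat_nat _ _ _ e) //=; last exact: leqW.
  rewrite zero // add0r -[X in index_iota X _]add0n big_addn subSn //.
  rewrite big_mkord h //.
  by apply: eq_bigr => q _; rewrite leq_addl addnK subnDA subnAC.
move=> d Phi dD h r m mD.
have E b q n : spart d (Phi b) q n = tpart d (Phi b q) n by [].
rewrite E /tpart h; last by rewrite mset1DE gtn_eqF.
rewrite mulr_sumr; apply: eq_bigr => e _; rewrite E /tpart msetDA.
by rewrite msetE2 msetnE ltn_eqF // addn0.
Qed.

(** Counting powers of s term by term would not do, as terms of order below N may cancel one
    another. Instead divisibility by s^N is applied to the encoded series. *)
Lemma KPtrans_eq_le i j N R G G' : (2 <= i)%N -> beta_divides N i j ->
  (forall q, (q <= R)%N -> G q = G' q) ->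
  KPtrans i j G (R + N)%N = KPtrans i j G' (R + N)%N.
Proof.
(* t_D is absent from m and is not differentiated in the equation. *)
move=> i2 hN GG; apply: tserP => m; pose D := (i + j + tbound m)%N.
have mD : m D = 0%N.
  apply/eqP; rewrite mset_eq0; apply/negP => /tbound_ub.
  by rewrite /D ltnNge leq_addl.
have ijD : (i + j <= D)%N by rewrite leq_addr.
(* [enc G] is constant in s; the coefficient of s^e in G, with t_D set to zero, becomes that of
   t_D^e. *)
pose enc (G : sser) : sser := fun e m =>
  if e == 0%N then G (m D) (m `\` msetn (m D) D) else 0.
have hsubst (X : sser) : subst_var D (fun b => if b then enc X else X).
  move=> r n nD; rewrite big_ord_recl big1 ?addr0 => [|e _]; last by [].
  by rewrite /enc /= subn0 msetE2 msetnxx nD add0n msetDKBC.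
have hmod : eqmod_var D R (fun b => if b then enc G else enc G').
  by move=> r n nR; rewrite /enc; case: ifP => // _; rewrite GG.
have E X := closed_KPtrans (subst_var_closed D) i2 ijD (hsubst X) (R + N)%N m mD.
rewrite /= in E; rewrite !E; apply: eq_bigr => e _.
(* For e < N both encoded sides vanish. For e >= N the exponent R + N - e of t_D is at most R, where
   the two encodings agree. *)
have [eN|Ne] := ltnP e N; first by rewrite !hN.
apply: (closed_KPtrans (eqmod_var_closed D R) i2 ijD hmod).
by rewrite msetE2 msetnxx mD; lia.
Qed.

(** * The conjugated equation *)

Definition conj_diffpoly alpha (Phi : (nat -> tser) -> sser) : Prop :=
  forall r, is_diffpoly (fun F => sexp (sopp (lop alpha)) (Phi F) r).

Lemma sopp_lop_smul alpha f g :
  sopp (lop alpha) (smul f g)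
  = smul (sopp (lop alpha) f) g + smul f (sopp (lop alpha) g).
Proof.
rewrite -[LHS]/(- lop alpha (smul f g)) lop_smul opprD.
congr (_ + _); last by rewrite -linearN.
by rewrite ![smul _ g]smulC -linearN.
Qed.

(** e^(-l) respects products and commutes with powers of s, and by [sexp_spart] it carries d/dt_d to
    an operator that is a finite sum at each order. No derivative is excluded, so D is arbitrary. *)
Lemma conj_diffpoly_closed alpha D : diffop_closed D (conj_diffpoly alpha).
Proof.
have hT := @sopp_lop_raising alpha.
split.
- move=> Phi Psi h1 h2 r; under eq_fun => F do rewrite linearD.
  exact: is_diffpolyD (h1 r) (h2 r).
- move=> c Phi h r; under eq_fun => F do rewrite linearZ.
  exact: is_diffpolyZ (h r).
- move=> Phi Psi h1 h2 r.
  under eq_fun => F do rewrite (sexp_smul _ _ hT (@sopp_lop_smul alpha)) smulE.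
  by apply: is_diffpoly_sum => q; exact: is_diffpolyM.
- move=> r; rewrite sexp_sone.
    have [P hP] := is_diffpolyZ (r == 0%N)%:R (is_diffpoly_mono [::]).
    by exists P => F; rewrite -hP big_nil.
  by rewrite -[LHS]/(- lop alpha sone) lop_sone oppr0.
- move=> e Phi h r.
  under eq_fun => F do rewrite (sexp_shift _ hT (@sopp_lop_shift alpha e)).
  by rewrite /shift; case: (e <= r)%N; [exact: h|exact: is_diffpoly0].
move=> d Phi _ h r; under eq_fun => F do rewrite sexp_spart.
by apply: is_diffpoly_sum => a; apply: is_diffpolyZ; exact: is_diffpoly_adpart.
Qed.

Lemma tparts0 w : tparts w 0 = 0.
Proof. by elim: w => //= d w ->; rewrite linear0. Qed.

(** [is_diffpoly] does not bound the indices of the unknowns. Setting those above k to zero kills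
    each term containing one, which amounts to deleting these terms from the list. *)
Lemma deval_truncate k P F :
  deval P (fun n => if (n <= k)%N then F n else 0)
  = deval [seq c <- P | all (fun u : nat * seq nat => (u.1 <= k)%N) c.2] F.
Proof.
rewrite !devalE big_filter [RHS]big_mkcond; apply: eq_bigr => -[c us] _ /=.
case: allP => [h|/allP].
  by congr (_ *: _); apply: eq_big_seq => u /h ->.
rewrite -has_predC => /hasP[u uus /= uk].
by rewrite (big_rem u) //= (negPf uk) tparts0 tmulC linear0 scaler0.
Qed.

(** Restores the factor s^N, with which e^(-l) commutes, so that conjugation can be computed on the
    undivided equation. *)
Lemma KPbar_shift N i j G : beta_divides N i j ->
  shift N (KPbar N i j G) = KPtrans i j G.
Proof.
move=> hN; apply: sserP => r; rewrite /shift /KPbar.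
case: leqP => Nr; first by rewrite subnK.
by apply: tserP => m; rewrite hN.
Qed.

Theorem theorem5 (M : hodge_data) (alpha : nat -> nat -> rat)
  (halpha : log_of_L alpha) (i j : nat) (hi : (2 <= i)%N) (hij : (i <= j)%N)
  (N : nat) (hN : beta_divides N i j) (r : nat) :
  exists P : diffpoly,
    [/\ involves_upto r./2 P,
        forall (F : nat -> tser) m,
          sexp (sopp (lop alpha)) (KPbar N i j (sexp (lop alpha) (zser F))) r m
          = deval P F m
      & (forall q m,
           KPbar N i j (sexp (lop alpha) (zser (hodgeF M))) q m = 0%R) ->
        forall m, deval P (hodgeF M) m = 0%R].
Proof.
have hT := @sopp_lop_raising alpha.
(* The exponentials cancel, so each coefficient is zero or, up to sign, a single unknown without
   derivatives. *)
have base : conj_diffpoly alpha (fun F => sexp (lop alpha) (zser F)).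
  move=> q; under eq_fun => F do rewrite (sexp_opp _ (@lop_raising alpha)).
  rewrite /zser; case: (odd q); first exact: is_diffpoly0.
  have [P hP] := is_diffpolyZ ((-1) ^+ q./2) (is_diffpoly_mono [:: (q./2, [::])]).
  by exists P => F; rewrite -hP big_seq1.
have [P hP] :=
  closed_KPtrans (conj_diffpoly_closed alpha (i + j)) hi (leqnn _) base (r + N)%N.
(* F is replaced by its truncation above r./2, which leaves the coefficient of s^r unchanged because
   neither exponential nor the divided equation looks beyond order r. The terms of P with later
   unknowns can then be deleted. *)
have conj F : sexp (sopp (lop alpha)) (KPbar N i j (sexp (lop alpha) (zser F))) r
    = deval [seq c <- P | all (fun u : nat * seq nat => (u.1 <= r./2)%N) c.2] F.
  rewrite -deval_truncate -hP -(KPbar_shift _ hN).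
  rewrite (sexp_shift _ hT (@sopp_lop_shift alpha N)) /shift leq_addl addnK.
  apply: sexp_eq_le => // q qr; apply: KPtrans_eq_le => // q' q'q.
  apply: sexp_eq_le => [|p pq']; first exact: lop_raising.
  apply: tserP => m; rewrite /zser; case: ifP => // _.
  by rewrite half_leq // (leq_trans pq') // (leq_trans q'q).
exists [seq c <- P | all (fun u : nat * seq nat => (u.1 <= r./2)%N) c.2].
split; first exact: filter_all.
  by move=> F m; rewrite conj.
move=> KP0 m; rewrite -conj.
rewrite (_ : KPbar _ _ _ _ = 0) ?linear0 //.
by apply: sserP => q; apply: tserP => m'; exact: KP0.
Qed.
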